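(* Let $P$ be a set of skew-indecomposable (non-empty) permutations and $n\ge0$. Then the staircase encoding $\mathrm{SE}$ is a bijection between $\mathrm{Av}^{(n)}(2314,3124,3142,1\oplus P)$ and $\mathrm{WI}(\mathcal{UDC}(B_n),\mathrm{Av}^{+}(2314,3124,3142,P))$.
   Context: A permutation of size $n$ is a word containing each of $1,\dots,n$ exactly once. $\sigma$ contains $\pi$ if some subsequence of $\sigma$ has the same relative order as $\pi$; otherwise it avoids $\pi$. $\mathrm{Av}(P)$ is the set of permutations avoiding every element of $P$, $\mathrm{Av}^{+}(P)$ its non-empty elements. For $\alpha$ of size $a$, $\beta$ of size $b$: $\alpha\ominus\beta=(\alpha_1+b)\cdots(\alpha_a+b)\beta_1\cdots\beta_b$; a permutation is skew-indecomposable if it is not $\alpha\ominus\beta$ with $\alpha,\beta$ non-empty. $1\oplus\pi=1(\pi_1+1)\cdots(\pi_m+1)$ and $1\oplus P=\{1\oplus\pi:\pi\in P\}$. The empty permutation is not in $P$. A left-to-right minimum of $\sigma$ is an entry $\sigma_i$ with $\sigma_j>\sigma_i$ for all $j<i$; $\mathrm{Av}^{(n)}(Q)$ is the set of permutations in $\mathrm{Av}(Q)$ with exactly $n$ left-to-right minima. $B_n=\{(i,j):1\le i\le j\le n\}$ (row $i$, column $j$, row 1 on top). If $\sigma$ has left-to-right minima at positions $p_1<\dots<p_n$ with values $v_1>\dots>v_n$, each non-minimum entry $\sigma_k$ lies in cell $(i,j)$ where $j$ is the largest index with $p_j<k$ and $i$ the smallest index with $v_i<\sigma_k$. $\mathrm{SE}(\sigma)$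 is the filling of $B_n$ putting in each cell the standardization of the entries of $\sigma$ in that cell (empty permutation if none). $\mathcal{UDC}(B_n)$ is the graph on $B_n$ in which distinct $(i,j),(k,\ell)$ are adjacent iff at least one of: (up) $i>k$ and $j<\ell$ (or symmetrically); (down) $i<k$, $j<\ell$ and $\{i,\dots,k\}\times\{j,\dots,\ell\}\subseteq B_n$ (or symmetrically); (column) $j=\ell$. For a graph $G$ on $B_n$ and a set $S$ of non-empty permutations, $\mathrm{WI}(G,S)$ is the set of fillings of $B_n$ whose non-empty cells form an independent set of $G$ and all contain elements of $S$. ''SE is a bijection between $X$ and $Y$'' means SE restricted to $X$ is injective with image exactly $Y$. *)

(* Defs.v *)
From mathcomp Require Import all_boot.
From mathcomp Require Import boolp classical_sets functions.

Set Implicit Arguments.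
Unset Strict Implicit.
Unset Printing Implicit Defensive.

Local Open Scope nat_scope.

(** Permutations are words over [1, ..., n]; [[::]] is the empty one. *)
Definition is_perm (s : seq nat) : bool := perm_eq s (iota 1 (size s)).

Definition order_iso (s t : seq nat) : Prop :=
  size s = size t /\
  forall i j, i < size s -> j < size s ->
    (nth 0 s i < nth 0 s j) = (nth 0 t i < nth 0 t j).

Definition contains (s p : seq nat) : Prop :=
  exists2 t, subseq t s & order_iso t p.

Definition skew_sum (a b : seq nat) : seq nat :=
  [seq x + size b | x <- a] ++ b.

Definition skew_indecomposable (p : seq nat) : Prop :=
  ~ exists a b, [/\ is_perm a, is_perm b, a != [::], b != [::]
                  & p = skew_sum a b].

Definition one_oplus (p : seq nat) : seq nat := 1 :: [seq x.+1 | x <- p].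

(** Correct for words with distinct letters only. *)
Definition standardize (s : seq nat) : seq nat :=
  [seq (count (fun y => y < x) s).+1 | x <- s].

Definition is_lrmin (s : seq nat) (k : nat) : bool :=
  all (fun l => nth 0 s k < nth 0 s l) (iota 0 k).

(** Positions are counted from 0. *)
Definition lrmin_pos (s : seq nat) : seq nat :=
  [seq k <- iota 0 (size s) | is_lrmin s k].

Definition lrmin_val (s : seq nat) : seq nat :=
  [seq nth 0 s k | k <- lrmin_pos s].

(** Rows and columns are indexed by 0, ..., n-1 instead of 1, ..., n. *)
Definition staircase (n : nat) : {set 'I_n * 'I_n} :=
  [set c : 'I_n * 'I_n | c.1 <= c.2]%SET.

Definition cell (n : nat) : finType := {c : 'I_n * 'I_n | c \in staircase n}.

Definition cell_row n (c : cell n) : 'I_n := (val c).1.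
Definition cell_col n (c : cell n) : 'I_n := (val c).2.

Definition filling (n : nat) : Type := {ffun cell n -> seq nat}.

Definition col_index (s : seq nat) (k j : nat) : bool :=
  let p := lrmin_pos s in
  [&& j < size p, nth 0 p j < k &
      all (fun j' => (nth 0 p j' < k) ==> (j' <= j)) (iota 0 (size p))].

Definition row_index (s : seq nat) (k i : nat) : bool :=
  let v := lrmin_val s in
  [&& i < size v, nth 0 v i < nth 0 s k &
      all (fun i' => (nth 0 v i' < nth 0 s k) ==> (i <= i')) (iota 0 (size v))].

Definition cell_entries (s : seq nat) (i j : nat) : seq nat :=
  [seq nth 0 s k | k <- iota 0 (size s) &
     [&& ~~ is_lrmin s k, row_index s k i & col_index s k j]].

(** Meant for words [s] with exactly [n] left-to-right minima; [n] is a
    separate argument so that all these encodings share one type. *)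
Definition SE (n : nat) (s : seq nat) : filling n :=
  [ffun c : cell n => standardize (cell_entries s (cell_row c) (cell_col c))].

Definition rectangle n (i k j l : 'I_n) : {set 'I_n * 'I_n} :=
  [set c : 'I_n * 'I_n | (i <= c.1 <= k) && (j <= c.2 <= l)]%SET.

Definition up_edge n (c d : cell n) : bool :=
  (cell_row d < cell_row c) && (cell_col c < cell_col d).

Definition down_edge n (c d : cell n) : bool :=
  [&& cell_row c < cell_row d, cell_col c < cell_col d &
      rectangle (cell_row c) (cell_row d) (cell_col c) (cell_col d) \subset staircase n].

Definition UDC (n : nat) : rel (cell n) := fun c d =>
  (c != d) &&
  [|| up_edge c d, up_edge d c, down_edge c d, down_edge d c
    | cell_col c == cell_col d].

Definition independent n (G : rel (cell n)) (A : {set cell n}) : Prop :=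
  forall c d, c \in A -> d \in A -> ~~ G c d.

Definition nonempty_cells n (f : filling n) : {set cell n} :=
  [set c : cell n | f c != [::]]%SET.

Local Open Scope classical_set_scope.

Definition Av (Q : set (seq nat)) : set (seq nat) :=
  [set s | is_perm s /\ forall q, Q q -> ~ contains s q].

Definition Av_plus (Q : set (seq nat)) : set (seq nat) :=
  [set s | Av Q s /\ s <> [::]].

Definition Av_lrmin (n : nat) (Q : set (seq nat)) : set (seq nat) :=
  [set s | Av Q s /\ size (lrmin_pos s) = n].

Definition WI n (G : rel (cell n)) (S : set (seq nat)) : set (filling n) :=
  [set f | independent G (nonempty_cells f) /\
           forall c, c \in nonempty_cells f -> S (f c)].

Definition basis3 : set (seq nat) :=
  [set [:: 2; 3; 1; 4]; [:: 3; 1; 2; 4]; [:: 3; 1; 4; 2]].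

(* Main.v *)
Require Import Defs.
From mathcomp Require Import all_boot order.
From mathcomp Require Import boolp classical_sets functions.
From mathcomp Require Import zify.

(** Cut a word into columns, each a left-to-right minimum followed by the entries
    up to the next one.  A word avoids 2314, 3124 and 3142 iff its columns do,
    every entry of a column exceeds every entry of a later one, and the minima
    satisfy a separation condition which, read on the cells, is independence in
    the graph UDC.  The non-minima then form the skew sum of the columns, so a copy
    of a skew-indecomposable [p] among them stays in one column, and a copy of
    [1 (+) p] yields a copy of [p] in a cell.  The order type of such a word depends
    only on its cells, whence injectivity; and an independent filling is realized by
    the word whose values are ordered lexicographically by row, column and entry. *)

Set Implicit Arguments.
Unset Strict Implicit.
Unset Printing Implicit Defensive.

(** * Order isomorphism and standardization *)

Lemma order_iso_sym s t : order_iso s t -> order_iso t s.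
Proof. by case=> est lt_st; split=> // i j; rewrite -est => ? ?; rewrite lt_st. Qed.

Lemma order_iso_trans t s u : order_iso s t -> order_iso t u -> order_iso s u.
Proof.
case=> est lt_st [etu lt_tu]; split=> [|i j lti ltj]; first by rewrite est.
by rewrite lt_st // lt_tu -?est.
Qed.

Lemma order_iso_map (f : nat -> nat) s :
  {in s &, {mono f : x y / x < y}} -> order_iso s (map f s).
Proof.
move=> fM; split=> [|i j lti ltj]; first by rewrite size_map.
by rewrite !(nth_map 0) // fM ?mem_nth.
Qed.

Lemma nth_zip_mem (T U : eqType) x0 y0 (s : seq T) (t : seq U) i :
  size s = size t -> i < size s -> (nth x0 s i, nth y0 t i) \in zip s t.
Proof.
by move=> est lti; rewrite -nth_zip // mem_nth // size_zip -est minnn.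
Qed.

Lemma mem_zip (T U : eqType) (s : seq T) (t : seq U) u :
  size s = size t -> u \in zip s t -> u.1 \in s /\ u.2 \in t.
Proof.
move=> est uz; rewrite -{1}[s](unzip1_zip (t := t)) ?est //.
by rewrite -{2}[t](unzip2_zip (s := s)) ?est //; split; apply: map_f.
Qed.

Lemma mask_zip (T U : Type) (b : bitseq) (s : seq T) (t : seq U) :
  size s = size t -> zip (mask b s) (mask b t) = mask b (zip s t).
Proof. by elim: b s t => [|[] b IH] [|x s] [|y t] //= [e]; rewrite ?IH. Qed.

Lemma order_iso_zip s t :
  order_iso s t <-> size s = size t /\
    {in zip s t &, forall u v, (u.1 < v.1) = (u.2 < v.2)}.
Proof.
split=> -[est lt_st]; split=> //.
  move=> u v /(nthP (0, 0)) [i + <-] /(nthP (0, 0)) [j + <-].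
  by rewrite !size_zip -est minnn => lti ltj; rewrite !nth_zip //=; apply: lt_st.
by move=> i j lti ltj; apply: (lt_st (_, _) (_, _)); apply: nth_zip_mem.
Qed.

Lemma order_iso_uniq s t : order_iso s t -> uniq s -> uniq t.
Proof.
move=> [est lt_st] us; apply/(uniqP 0) => i j; rewrite !inE -est => lti ltj e.
apply/eqP; rewrite -(nth_uniq 0 lti ltj us).
by case: ltngtP; rewrite // lt_st // e ltnn.
Qed.

Lemma count_ltn_mono (s : seq nat) :
  {in s &, {mono (fun x => count (fun z => z < x) s) : x y / x < y}}.
Proof.
have count_lt x y : x \in s -> x < y ->
    count (fun z => z < x) s < count (fun z => z < y) s.
  move=> xs xy; apply: (@leq_trans (count (fun z => z <= x) s)).
    by rewrite (Order.POrderTheory.count_lt_le_mem x s).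
  by apply: sub_count => z /= /leq_ltn_trans; apply.
move=> x y xs ys; case: (ltngtP x y) => [/(count_lt _ _ xs)->//|/(count_lt _ _ ys)|->].
  by move/ltnW; rewrite ltnNge => ->.
exact: ltnn.
Qed.

Lemma order_iso_standardize s : order_iso s (standardize s).
Proof. by apply: order_iso_map => x y xs ys; rewrite ltnS count_ltn_mono. Qed.

Lemma standardizeP s t : standardize s = standardize t <-> order_iso s t.
Proof.
split=> [e|[est lt_st]].
  apply: (order_iso_trans (order_iso_standardize s)).
  by rewrite e; apply/order_iso_sym/order_iso_standardize.
apply: (@eq_from_nth _ 0); rewrite !size_map // => i lti.
rewrite !(nth_map 0) -?est //; congr S.
rewrite -{2}[s](mkseq_nth 0) -{2}[t](mkseq_nth 0) !count_map -est.
by apply: eq_in_count => j; rewrite mem_iota /= => ltj; rewrite lt_st.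
Qed.

Lemma standardize_nil s : (standardize s == [::]) = (s == [::]).
Proof. by case: s. Qed.

Lemma is_perm_uniq s : is_perm s -> uniq s.
Proof. by move/perm_uniq ->; apply: iota_uniq. Qed.

Lemma mem_is_perm s x : is_perm s -> (x \in s) = (0 < x <= size s).
Proof. by move/perm_mem ->; rewrite mem_iota add1n ltnS. Qed.

Lemma standardize_is_perm s : is_perm s -> standardize s = s.
Proof.
move=> ps; rewrite -[RHS]map_id; apply/eq_in_map => x.
rewrite mem_is_perm // => /andP [x_gt0 le_xs].
have le_x1 := leq_trans (leq_pred x) le_xs.
have := filter_iota_ltn 1 le_x1; rewrite add1n prednK // => iota_lt_x.
by rewrite (seq.permP ps) -size_filter iota_lt_x size_iota prednK.
Qed.

Lemma is_perm_standardize s : uniq s -> is_perm (standardize s).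
Proof.
move=> us; have ust := order_iso_uniq (order_iso_standardize s) us.
apply: uniq_perm => //; first exact: iota_uniq.
apply: (uniq_min_size ust _ _).2; last by rewrite size_iota.
move=> _ /mapP [x xs ->]; rewrite mem_iota size_map add1n /= !ltnS.
apply: leq_trans (count_size (fun y => y <= x) s).
by rewrite (Order.POrderTheory.count_lt_le_mem x s).
Qed.

Lemma order_iso_is_perm_eq s t : is_perm s -> is_perm t -> order_iso s t -> s = t.
Proof.
by move=> /standardize_is_perm {2}<- /standardize_is_perm {2}<- /standardizeP.
Qed.

(** * Containment *)

Lemma contains_subseq s t q : subseq s t -> contains s q -> contains t q.
Proof. by move=> st [u us]; exists u => //; apply: subseq_trans st. Qed.

Lemma contains_order_iso s t q : order_iso s t -> contains s q -> contains t q.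
Proof.
move=> /order_iso_zip [est lt_st] [u /subseqP [b sb ->] isq].
exists (mask b t); first by apply/subseqP; exists b; rewrite -?est.
apply: order_iso_trans isq; apply/order_iso_sym/order_iso_zip; split.
  by rewrite !size_mask -?est.
by move=> v w; rewrite mask_zip // => /mem_mask vst /mem_mask; apply: lt_st.
Qed.

Lemma contains_standardize s q : contains (standardize s) q <-> contains s q.
Proof.
by split; apply: contains_order_iso; first apply: order_iso_sym;
  apply: order_iso_standardize.
Qed.

(* Reading [s] in the order in which [q] takes the values 1, 2, ... *)
Lemma order_iso_sorted s q : is_perm q ->
  order_iso s q <->
  size s = size q /\ sorted ltn [seq nth 0 s (index v q) | v <- iota 1 (size q)].
Proof.
move=> pq; have qE v : (v \in iota 1 (size q)) = (v \in q) by rewrite (perm_mem pq).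
split=> [[sz lt_sq]|[sz so]]; split=> //.
  apply: (homo_sorted_in (P := mem q)) (iota_ltn_sorted 1 (size q)); last first.
    by apply/allP => v; rewrite qE.
  by move=> v w vq wq vw; rewrite /= lt_sq ?sz ?index_mem // !nth_index.
have lt_nth i j : i < size q -> j < size q ->
    nth 0 q i < nth 0 q j -> nth 0 s i < nth 0 s j.
  move=> lti ltj; have := mem_nth 0 lti; have := mem_nth 0 ltj.
  rewrite !mem_is_perm // => /andP [j_gt0 ljq] /andP [i_gt0 liq] lt_ij.
  have := sorted_ltn_nth ltn_trans 0 so (nth 0 q i).-1 (nth 0 q j).-1.
  rewrite !inE size_map size_iota !prednK // => /(_ liq ljq).
  rewrite !(nth_map 0) ?size_iota ?prednK // !nth_iota ?prednK // !add1n !prednK //.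
  by rewrite !index_uniq ?(is_perm_uniq pq) //; apply; rewrite -ltnS !prednK.
move=> i j; rewrite sz => lti ltj; case: (ltngtP (nth 0 q i)) => [ij|ji|e].
- exact: lt_nth ij.
- by rewrite ltnNge ltnW // lt_nth.
- by move/uniqP: (is_perm_uniq pq) => /(_ 0 i j lti ltj e) ->; rewrite ltnn.
Qed.

Lemma contains_size4P s q : is_perm q -> size q = 4 ->
  contains s q <-> exists a b c d, subseq [:: a; b; c; d] s /\
    sorted ltn [seq nth 0 [:: a; b; c; d] (index v q) | v <- iota 1 4].
Proof.
move=> pq q4; split=> [[t ts /(order_iso_sorted _ pq) []]|[a [b [c [d [ts so]]]]]].
  by rewrite q4; case: t ts => [|a [|b [|c [|d []]]]] // ts _ so; exists a, b, c, d.
by exists [:: a; b; c; d] => //; apply/(order_iso_sorted _ pq); rewrite q4.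
Qed.

Lemma contains_2314 s : contains s [:: 2; 3; 1; 4] <->
  exists a b c d, subseq [:: a; b; c; d] s /\ sorted ltn [:: c; a; b; d].
Proof. exact: contains_size4P. Qed.

Lemma contains_3124 s : contains s [:: 3; 1; 2; 4] <->
  exists a b c d, subseq [:: a; b; c; d] s /\ sorted ltn [:: b; c; a; d].
Proof. exact: contains_size4P. Qed.

Lemma contains_3142 s : contains s [:: 3; 1; 4; 2] <->
  exists a b c d, subseq [:: a; b; c; d] s /\ sorted ltn [:: b; d; a; c].
Proof. exact: contains_size4P. Qed.

Lemma order_iso_one_oplus a u p : is_perm p ->
  order_iso (a :: u) (one_oplus p) <-> order_iso u p /\ all (ltn a) u.
Proof.
move=> pp; have p_gt0 i : i < size p -> 0 < nth 0 p i.
  by move=> lti; have := mem_nth 0 lti; rewrite mem_is_perm // => /andP [].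
split=> [[[sz] lt_up]|[[sz lt_up] /allP au]].
  rewrite size_map in sz; split; last first.
    apply/(all_nthP 0) => i lti; rewrite /= (lt_up 0 i.+1) //= (nth_map 0) -?sz //.
    by rewrite ltnS p_gt0 // -sz.
  split=> // i j lti ltj; have := lt_up i.+1 j.+1 lti ltj.
  by rewrite /= !(nth_map 0) -?sz // ltnS.
split=> [|[|i] [|j]] /=; rewrite ?size_map ?sz ?ltnn // ?ltnS => lti ltj.
- by rewrite (nth_map 0) // ltnS p_gt0 //; apply/au/mem_nth; rewrite sz.
- by rewrite (nth_map 0) // ltnNge ltnW //; apply/au/mem_nth; rewrite sz.
- by rewrite !(nth_map 0) // ltnS lt_up // sz.
Qed.

Lemma standardize_cat s t : allrel gtn s t ->
  standardize (s ++ t) = skew_sum (standardize s) (standardize t).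
Proof.
move=> /allrelP gt_st; rewrite /skew_sum /standardize map_cat size_map -map_comp.
congr (_ ++ _); apply/eq_in_map => x xs /=; rewrite count_cat.
  rewrite addSn (eq_in_count (s := t) (a2 := predT)) ?count_predT // => y yt.
  exact: gt_st.
rewrite (eq_in_count (s := s) (a2 := pred0)) ?count_pred0 // => y ys.
by apply/negbTE; rewrite -leqNgt ltnW //; apply: gt_st.
Qed.

Lemma skew_indecomposable_cat p u v : is_perm p -> skew_indecomposable p ->
  order_iso (u ++ v) p -> allrel gtn u v -> u = [::] \/ v = [::].
Proof.
move=> pp sp iso gt_uv; case: (eqVneq u [::]) => [|u0]; first by left.
case: (eqVneq v [::]) => [|v0]; [by right | case: sp].
have := order_iso_uniq (order_iso_sym iso) (is_perm_uniq pp).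
rewrite cat_uniq => /and3P [uu _ uv].
exists (standardize u), (standardize v).
split; rewrite ?is_perm_standardize ?standardize_nil //.
by rewrite -standardize_cat // ((standardizeP _ _).2 iso) standardize_is_perm.
Qed.

Lemma nonnil_mem (T : eqType) (s : seq T) : s != [::] -> exists x, x \in s.
Proof. by case: s => [//|x s] _; exists x; apply: mem_head. Qed.

Lemma subseq_catP (T : eqType) (t s1 s2 : seq T) :
  reflect (exists t1 t2, [/\ t = t1 ++ t2, subseq t1 s1 & subseq t2 s2])
          (subseq t (s1 ++ s2)).
Proof.
apply: (iffP idP) => [/subseqP [b]|[t1 [t2 [-> ? ?]]]]; last exact: cat_subseq.
rewrite size_cat => sb ->.
exists (mask (take (size s1) b) s1), (mask (drop (size s1) b) s2).
by rewrite -mask_cat ?cat_take_drop ?mask_subseq // size_takel // sb leq_addr.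
Qed.

Lemma skew_indecomposable_flatten p ss : is_perm p -> p <> [::] ->
  skew_indecomposable p -> pairwise (allrel gtn) ss ->
  contains (flatten ss) p -> exists2 s, s \in ss & contains s p.
Proof.
move=> pp p0 sp; elim: ss => [_ [t]|s ss IH /= /andP [/allP gt_s gt_ss] [t]].
  by rewrite subseq0 => /eqP -> [/esym/size0nil].
case/subseq_catP=> u [v [-> us vss]] iso.
have gt_uv : allrel gtn u v.
  apply/allrelP => x y /(mem_subseq us) xs /(mem_subseq vss) /flattenP [s' s'ss ys'].
  by move/allrelP: (gt_s s' s'ss); apply.
case: (skew_indecomposable_cat pp sp iso gt_uv) => e; rewrite e ?cats0 /= in iso.
  have [|s' s'ss ?] := IH gt_ss; first by exists v.
  by exists s' => //; rewrite inE s'ss orbT.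
by exists s; [exact: mem_head | exists u].
Qed.

(** * Precedence in a word *)

Definition precedes (T : eqType) (s : seq T) : rel T :=
  fun x y => index x s < index y s.

Lemma precedesxx (T : eqType) (s : seq T) x : precedes s x x = false.
Proof. exact: ltnn. Qed.

Lemma precedes_trans (T : eqType) (s : seq T) : transitive (precedes s).
Proof. by move=> y x z; apply: ltn_trans. Qed.

Lemma pairwise_precedes (T : eqType) (s : seq T) :
  uniq s -> pairwise (precedes s) s.
Proof.
case: s => [//|x0 s] us; apply/(pairwiseP x0) => i j; rewrite !inE => lti ltj ij.
by rewrite /precedes !index_uniq.
Qed.

Lemma subseq_precedes (T : eqType) (s t : seq T) : uniq s ->
  subseq t s = all (mem s) t && sorted (precedes s) t.
Proof.
move=> us; apply/idP/andP => [ts|[/allP ts st]].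
  split; first exact/allP/mem_subseq.
  exact/pairwise_sorted/(subseq_pairwise ts)/pairwise_precedes.
apply/(subseq_uniqP us); apply: (irr_sorted_eq (@precedes_trans _ s)) => // [x||x].
- exact: precedesxx.
- apply: (sorted_filter (@precedes_trans _ s)).
  exact/pairwise_sorted/pairwise_precedes.
- by rewrite mem_filter; case: (boolP (x \in t)) => // /ts /= ->.
Qed.

(** * Words cut into columns *)

Definition word (m : nat -> nat) (c : nat -> seq nat) (n : nat) : seq nat :=
  flatten (mkseq (fun j => m j :: c j) n).

Definition lrmin_columns (m : nat -> nat) (c : nat -> seq nat) (n : nat) : Prop :=
  forall j x, j < n -> x \in word m c j ++ c j -> m j < x.

Lemma wordS m c n : word m c n.+1 = word m c n ++ m n :: c n.
Proof. by rewrite /word mkseqS flatten_rcons. Qed.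

Lemma mem_word m c n x :
  reflect (exists2 j, j < n & x \in m j :: c j) (x \in word m c n).
Proof.
apply: (iffP flatten_mapP) => -[j jn xj]; exists j => //.
  by move: jn; rewrite mem_iota.
by rewrite mem_iota.
Qed.

Lemma mem_word_lrmin (m : nat -> nat) c n j : j < n -> m j \in word m c n.
Proof. by move=> jn; apply/mem_word; exists j; rewrite ?mem_head. Qed.

Lemma mem_word_column (m : nat -> nat) (c : nat -> seq nat) n j x :
  j < n -> x \in c j -> x \in word m c n.
Proof. by move=> jn xj; apply/mem_word; exists j; rewrite // inE xj orbT. Qed.

Lemma eq_in_word m c m' c' n : {in gtn n, m =1 m'} -> {in gtn n, c =1 c'} ->
  word m c n = word m' c' n.
Proof.
move=> em ec; congr flatten; apply/eq_in_map => j; rewrite mem_iota => jn.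
by rewrite em ?ec.
Qed.

Lemma prefix_word m c i n : i <= n -> prefix (word m c i) (word m c n).
Proof.
move=> /subnKC <-; rewrite /word /mkseq iotaD map_cat flatten_cat.
exact: prefix_prefix.
Qed.

Lemma prefix_word_column m c j n : j < n ->
  prefix (word m c j ++ m j :: c j) (word m c n).
Proof. by rewrite -wordS; apply: prefix_word. Qed.

Lemma column_subseq_word m c j n : j < n -> subseq (m j :: c j) (word m c n).
Proof.
move=> /(prefix_word_column m c)/prefixP [t ->].
by rewrite -catA; apply: subseq_trans (prefix_subseq _ t) (suffix_subseq _ _).
Qed.

Lemma lrmin_columnsW m c i n : i <= n -> lrmin_columns m c n -> lrmin_columns m c i.
Proof. by move=> le_in mc j x ji; apply: mc (leq_trans ji le_in). Qed.

Lemma uniq_word m c n : lrmin_columns m c n ->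
  (forall j, j < n -> uniq (c j)) ->
  (forall j x, j < n -> x \in c j -> x \notin word m c j) -> uniq (word m c n).
Proof.
elim: n => [//|n IH] mc uc dis; have nn := ltnSn n.
rewrite wordS cat_uniq /= uc // IH; last first.
- by move=> j x /ltnW; apply: dis.
- by move=> j /ltnW; apply: uc.
- exact: lrmin_columnsW mc.
have mn_notin_w : m n \notin word m c n.
  by apply/negP => mw; have := mc n (m n) nn; rewrite mem_cat mw ltnn => /(_ isT).
have mn_notin_c : m n \notin c n.
  by apply/negP => mw; have := mc n (m n) nn; rewrite mem_cat mw orbT ltnn => /(_ isT).
rewrite negb_or mn_notin_w mn_notin_c andTb !andbT.
by apply/hasPn => x; apply: dis.
Qed.

Lemma uniq_min_split (s : seq nat) : uniq s -> s != [::] ->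
  exists s1 x s2, s = s1 ++ x :: s2 /\ all (ltn x) (s1 ++ s2).
Proof.
move=> us; case: s us => [//|x0 s] us _; set w := x0 :: s in us *.
have exw : exists x, x \in w by exists x0; apply: mem_head.
case: (ex_minnP exw) => x xw x_min.
case/splitPr: xw us x_min => s1 s2; rewrite uniq_catC cat_cons => /= /andP [xs _] x_min.
exists s1, x, s2; split=> //; apply/allP => y ys; rewrite /= ltn_neqAle x_min.
  by rewrite andbT; apply: contraNneq xs => ->; move: ys; rewrite !mem_cat orbC.
by move: ys; rewrite !mem_cat inE => /orP [->|->]; rewrite ?orbT.
Qed.

(* The last column starts at the smallest entry. *)
Lemma word_exists s : uniq s ->
  exists n m c, s = word m c n /\ lrmin_columns m c n.
Proof.
have [k] := ubnP (size s); elim: k s => // k IH s lt_sk us.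
case: (eqVneq s [::]) => [->|/(uniq_min_split us) [s1 [x [s2 [es /allP x_min]]]]].
  by exists 0, id, (fun=> [::]).
have [| |n [m [c [es1 mc]]]] := IH s1.
- by move: lt_sk; rewrite es size_cat /=; lia.
- by move: us; rewrite es cat_uniq => /andP [].
pose m' := [eta m with n |-> x]; pose c' j := if j == n then s2 else c j.
have ew j : j <= n -> word m' c' j = word m c j.
  by move=> jn; apply: eq_in_word => i /= ij; rewrite /c' ?ltn_eqF // (leq_trans ij).
exists n.+1, m', c'; split; first by rewrite wordS ew // /c' /= eqxx -es1.
move=> j y; rewrite ltnS => jn; rewrite ew // /c' /=; case: eqP => [->|/eqP neq_jn].
  by rewrite -es1; apply: x_min.
by apply: mc; rewrite ltn_neqAle neq_jn.
Qed.

(** * The staircase encoding of a word *)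

Lemma lrmin_pos_lt s k : k \in lrmin_pos s -> k < size s.
Proof. by rewrite mem_filter mem_iota => /andP []. Qed.

Lemma is_lrminE s k : k <= size s ->
  is_lrmin s k = all (ltn (nth 0 s k)) (take k s).
Proof. by move=> ks; rewrite -(map_nth_iota0 0 ks) all_map. Qed.

Lemma lrmin_pos_rcons s x : lrmin_pos (rcons s x) =
  if all (ltn x) s then rcons (lrmin_pos s) (size s) else lrmin_pos s.
Proof.
rewrite /lrmin_pos size_rcons -addn1 iotaD filter_cat /= add0n.
rewrite is_lrminE ?size_rcons // nth_rcons ltnn eqxx -cats1 take_size_cat //.
rewrite (@eq_in_filter _ _ (is_lrmin s)) => [|k].
  by case: ifP => _; rewrite ?cats0 ?cats1.
rewrite mem_iota => /= ks; rewrite !is_lrminE ?size_cat ?leq_addr 1?ltnW ?ltn_addr //.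
by rewrite takel_cat 1?ltnW // nth_cat ks.
Qed.

Lemma lrmin_pos_cat s t : {in t, forall y, has (gtn y) s} ->
  lrmin_pos (s ++ t) = lrmin_pos s.
Proof.
elim/last_ind: t => [|t y IH] lt_s; first by rewrite cats0.
rewrite -rcons_cat lrmin_pos_rcons IH => [|z zt]; last first.
  by apply: lt_s; rewrite mem_rcons inE zt orbT.
have /hasP [x xs xy] : has (gtn y) s by apply: lt_s; rewrite mem_rcons mem_head.
case: ifP => // /allP /(_ x); rewrite mem_cat xs => /(_ isT) /=.
by rewrite ltnNge ltnW.
Qed.

Lemma row_indexE s k i : row_index s k i =
  (i < size (lrmin_val s)) && (find (gtn (nth 0 s k)) (lrmin_val s) == i).
Proof.
rewrite /row_index; set v := lrmin_val s; set x := nth 0 s k.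
case: ltnP => //= iv; apply/andP/eqP => [[vix /allP i_min]|e_i].
  apply/eqP; rewrite eqn_leq; apply/andP; split.
    by rewrite leqNgt; apply/negP => /(before_find 0) /=; rewrite vix.
  have hv : has (gtn x) v by apply/(has_nthP 0); exists i.
  have := i_min (find (gtn x) v); rewrite mem_iota /= -has_find hv.
  by have /= -> := nth_find 0 hv; apply.
have hv : has (gtn x) v by rewrite has_find e_i.
split; first by have := nth_find 0 hv; rewrite e_i.
apply/allP => i' _; apply/implyP => vi'x; rewrite leqNgt -e_i.
by apply/negP => /(before_find 0) /=; rewrite vi'x.
Qed.

Section StaircaseEncodingOfWord.
Variables (m : nat -> nat) (c : nat -> seq nat).
Implicit Types (n i j k x : nat).

Definition row_of n x : nat := find (gtn x) (mkseq m n).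

Lemma nth_word n j k : j < n -> k <= size (c j) ->
  nth 0 (word m c n) (size (word m c j) + k) = nth 0 (m j :: c j) k.
Proof.
move=> /(prefix_word_column m c)/prefixP [t ->] kj.
by rewrite -catA nth_cat ltnNge leq_addr addKn nth_cat /= ltnS kj.
Qed.

Lemma size_wordS n : size (word m c n.+1) = size (word m c n) + (size (c n)).+1.
Proof. by rewrite wordS size_cat. Qed.

Lemma ltn_size_word i j : (size (word m c i) < size (word m c j)) = (i < j).
Proof.
have mono : {homo (fun j => size (word m c j)) : i j / i < j}.
  apply: homo_ltn => [? ? ?|k]; first exact: ltn_trans.
  by rewrite size_wordS addnS ltnS leq_addr.
exact: (leqW_mono (leq_mono mono)).
Qed.

Lemma lrmin_pos_word n : lrmin_columns m c n ->
  lrmin_pos (word m c n) = mkseq (fun j => size (word m c j)) n.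
Proof.
elim: n => // n IH mc; rewrite mkseqS -IH; last exact: lrmin_columnsW mc.
rewrite wordS -cat_rcons lrmin_pos_cat => [|x xn].
  rewrite lrmin_pos_rcons ifT //; apply/allP => x xw.
  by apply: mc; rewrite // mem_cat xw.
apply/hasP; exists (m n); first by rewrite mem_rcons mem_head.
by apply: mc; rewrite // mem_cat xn orbT.
Qed.

Lemma lrmin_val_word n : lrmin_columns m c n -> lrmin_val (word m c n) = mkseq m n.
Proof.
move=> mc; rewrite /lrmin_val lrmin_pos_word // -map_comp.
apply/eq_in_map => j; rewrite mem_iota => /= jn.
by rewrite -[X in nth 0 _ X]addn0 nth_word.
Qed.

Lemma col_index_word n j k : lrmin_columns m c n -> j < n ->
  k < size (word m c n) ->
  ~~ is_lrmin (word m c n) k && col_index (word m c n) k j =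
  (size (word m c j) < k < size (word m c j.+1)).
Proof.
move=> mc jn kw; set w := word m c n in kw *; pose p i := size (word m c i).
have lrminE : is_lrmin w k = (k \in mkseq p n).
  by rewrite -[mkseq p n](lrmin_pos_word mc) mem_filter mem_iota /= kw andbT.
rewrite lrminE /col_index lrmin_pos_word // size_mkseq jn nth_mkseq // andTb -!/(p _).
apply/and3P/andP => [[notin_k jk /allP j_max]|[jk kj]]; split=> //.
- rewrite ltnNge; apply: contra notin_k; rewrite leq_eqVlt => /predU1P [e|lt_pk].
    apply/mapP; exists j.+1 => //; rewrite mem_iota -(ltn_size_word j.+1 n).
    by rewrite -/(p _) e.
  have j1n : j.+1 < n by rewrite -(ltn_size_word j.+1 n) (ltn_trans lt_pk).
  have := j_max j.+1; rewrite mem_iota nth_mkseq // -/(p _) lt_pk.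
  by move=> /(_ j1n); rewrite ltnn.
- apply/mapP => -[i _ e]; move: jk kj; rewrite e !ltn_size_word ltnS.
  by move=> /leq_trans le_j /le_j; rewrite ltnn.
- apply/allP => i; rewrite mem_iota => /= lt_in; rewrite nth_mkseq // -/(p _).
  by apply/implyP => ik; rewrite -ltnS -(ltn_size_word i) (ltn_trans ik).
Qed.

Lemma cell_entries_word n i j : lrmin_columns m c n -> i < n -> j < n ->
  cell_entries (word m c n) i j = [seq x <- c j | row_of n x == i].
Proof.
move=> mc lt_in jn; set w := word m c n; set p := size (word m c j).
have le_w : p + (size (c j)).+1 <= size w.
  by rewrite -size_wordS leqNgt ltn_size_word -leqNgt.
have -> : c j = [seq nth 0 w k | k <- iota p.+1 (size (c j))].
  apply: (@eq_from_nth _ 0) => [|k kj]; first by rewrite size_map size_iota.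
  by rewrite (nth_map 0) ?size_iota // nth_iota // addSnnS nth_word ?(ltnW kj).
rewrite filter_map /cell_entries; congr map; apply: (irr_sorted_eq ltn_trans ltnn).
- exact/sorted_filter/iota_ltn_sorted/ltn_trans.
- exact/sorted_filter/iota_ltn_sorted/ltn_trans.
move=> k; rewrite !mem_filter !mem_iota row_indexE lrmin_val_word // size_mkseq lt_in.
rewrite /= -/(row_of n _) andbCA -andbA; congr (_ && _).
case: (ltnP k (size w)) => kw; last by lia.
by rewrite andbT col_index_word // size_wordS addnS -addSn.
Qed.

Lemma SE_word n (d : cell n) : lrmin_columns m c n ->
  SE n (word m c n) d =
  standardize [seq x <- c (cell_col d) | row_of n x == cell_row d].
Proof. by move=> mc; rewrite ffunE cell_entries_word. Qed.

Lemma row_of_leq n x i : lrmin_columns m c n -> i < n ->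
  (row_of n x <= i) = (m i < x).
Proof.
move=> mc lt_in; apply/idP/idP => [le_i|mix]; last first.
  by rewrite leqNgt; apply/negP => /(before_find 0) /=; rewrite nth_mkseq // mix.
have := leq_ltn_trans le_i lt_in; rewrite -{2}(size_mkseq m n) -has_find.
move=> /(nth_find 0); rewrite /= nth_mkseq -/(row_of n x) ?(leq_ltn_trans le_i) //.
apply: leq_ltn_trans; move: le_i; rewrite leq_eqVlt => /predU1P [->//|lt_i].
by rewrite ltnW // mc // mem_cat mem_word_lrmin.
Qed.

End StaircaseEncodingOfWord.

(** * Avoidance and skew columns *)

Definition avoids (Q : set (seq nat)) (s : seq nat) : Prop :=
  forall q, Q q -> ~ contains s q.

Definition columns_decrease (m : nat -> nat) (c : nat -> seq nat) (n : nat) : Prop :=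
  forall i j x y, i < j -> j < n -> x \in c i -> y \in c j -> y < x.

(* Read on cells: if the row of [y] meets the column of [x] in the staircase, then
   it is not below the row of [x]; see [independent_UDCP]. *)
Definition minima_separate (m : nat -> nat) (c : nat -> seq nat) (n : nat) : Prop :=
  forall i j l x y, i < n -> j < n -> l < n -> x \in c i -> y \in c j ->
    m i < y -> m l < x -> m l < y.

Definition skew_columns m c n : Prop :=
  columns_decrease m c n /\ minima_separate m c n.

Section SkewColumns.
Variables (m : nat -> nat) (c : nat -> seq nat) (n : nat).
Local Notation w := (word m c n).
Hypotheses (mc : lrmin_columns m c n) (uw : uniq w).
Implicit Types (i j l x y : nat).

Lemma lrmin_lt_column j x : j < n -> x \in c j -> m j < x.
Proof. by move=> jn xj; apply: mc; rewrite // mem_cat xj orbT. Qed.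

Lemma ltn_lrmin i j : i < n -> j < n -> (m i < m j) = (j < i).
Proof.
have lrmin_dec k l : k < l -> l < n -> m l < m k.
  by move=> kl ln; apply: mc; rewrite // mem_cat mem_word_lrmin.
move=> lt_in jn; case: (ltngtP i j) => [ij|ji|->]; last exact: ltnn.
- by rewrite ltnNge ltnW ?lrmin_dec.
- exact: lrmin_dec.
Qed.

Lemma lrmin_leq_column i j x : i <= j -> j < n -> x \in m i :: c i -> m j <= x.
Proof.
move=> ij jn xi; have lt_in := leq_ltn_trans ij jn.
apply: (@leq_trans (m i)); first by rewrite leqNgt ltn_lrmin // -leqNgt.
by move: xi; rewrite inE => /predU1P [->//|/(lrmin_lt_column lt_in)/ltnW].
Qed.

Lemma precedes_columns i j x y : i < j -> j < n ->
  x \in m i :: c i -> y \in m j :: c j -> precedes w x y.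
Proof.
move=> ij jn xi yj; have xw : x \in word m c j by apply/mem_word; exists i.
suff: subseq [:: x; y] w by rewrite subseq_precedes // => /andP [_ /andP []].
have [t ->] := prefixP (prefix_word_column m c jn); rewrite -catA.
by apply: (@cat_subseq _ [:: x] [:: y]); rewrite sub1seq // mem_cat yj.
Qed.

Lemma leq_precedes i j x y : i < n -> x \in m i :: c i -> y \in m j :: c j ->
  precedes w x y -> i <= j.
Proof.
move=> lt_in xi yj xy; rewrite leqNgt; apply/negP => ji.
by have := precedes_trans xy (precedes_columns ji lt_in yj xi); rewrite precedesxx.
Qed.

Lemma precedes_lrmin i j x : i <= j -> j < n -> x \in c j -> precedes w (m i) x.
Proof.
move=> + jn xj; have xj' : x \in m j :: c j by rewrite inE xj orbT.
rewrite leq_eqVlt => /predU1P [->|ij]; last exact: precedes_columns (mem_head _ _) xj'.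
have : subseq [:: m j; x] w.
  by apply: subseq_trans (column_subseq_word m c jn); rewrite /= eqxx sub1seq.
by rewrite subseq_precedes // => /andP [_ /andP []].
Qed.

Lemma column_neq_lrmin i j x : i < n -> j < n -> x \in c j -> x != m i.
Proof.
move=> lt_in jn xj; apply/eqP => e.
suff : precedes w x x by rewrite precedesxx.
case: (leqP i j) => [ij|ji]; first by rewrite {1}e; apply: precedes_lrmin ij jn xj.
by rewrite {2}e; apply: (precedes_columns ji); rewrite ?mem_head // inE xj orbT.
Qed.

Lemma column_notin_lrmin j x : j < n -> x \in c j -> x \notin mkseq m n.
Proof.
move=> jn xj; apply/mapP => -[i]; rewrite mem_iota => /= lt_in /eqP.
by rewrite (negbTE (column_neq_lrmin lt_in jn xj)).
Qed.

Lemma ltn_column_lrmin i j x : i < n -> j < n -> x \in c j ->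
  (x < m i) = ~~ (m i < x).
Proof.
by move=> lt_in jn xj; rewrite ltn_neqAle (column_neq_lrmin lt_in jn xj) leqNgt.
Qed.

Lemma ascent_column x y : x \in w -> y \in w -> precedes w x y -> x < y ->
  exists2 j, j < n & y \in c j.
Proof.
move=> /mem_word [i lt_in xi] /mem_word [j jn yj] xy lt_xy; exists j => //.
move: (yj); rewrite inE => /predU1P [ey|//]; move: lt_xy.
by rewrite ltnNge ey (lrmin_leq_column _ jn xi) // (leq_precedes lt_in xi yj).
Qed.

Lemma filter_mem_column j : j < n -> [seq x <- w | x \in c j] = c j.
Proof.
move=> jn; apply/esym/(subseq_uniqP uw).
exact: subseq_trans (subseq_cons _ _) (column_subseq_word m c jn).
Qed.

Lemma subseq_column j t : j < n -> subseq t w -> all (mem (c j)) t -> subseq t (c j).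
Proof. by move=> jn tw tj; rewrite -(filter_mem_column jn) subseq_filter tj. Qed.

Lemma avoid_columns_decrease : ~ contains w [:: 2; 3; 1; 4] -> columns_decrease m c n.
Proof.
move=> av i j x y ij jn xi yj; have lt_in := ltn_trans ij jn.
have xj : precedes w x (m j).
  by apply: (precedes_columns ij); rewrite ?mem_head // inE xi orbT.
have jy : precedes w (m j) y by apply: precedes_lrmin yj.
have neq_xy : x != y.
  by apply/eqP => e; have := precedes_trans xj jy; rewrite e precedesxx.
rewrite ltn_neqAle eq_sym neq_xy leqNgt; apply/negP => xy; apply/av/contains_2314.
exists (m i), x, (m j), y; split; last first.
  by rewrite /= ltn_lrmin // ij (lrmin_lt_column lt_in xi) xy.
rewrite subseq_precedes //= !mem_word_lrmin ?(mem_word_column m lt_in xi)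
  ?(mem_word_column m jn yj) //=.
by rewrite xj jy (precedes_lrmin _ lt_in xi).
Qed.

Lemma avoid_minima_separate : columns_decrease m c n ->
  ~ contains w [:: 3; 1; 2; 4] -> ~ contains w [:: 3; 1; 4; 2] ->
  minima_separate m c n.
Proof.
move=> dec av3124 av3142 i j l x y lt_in jn ln xi yj iy lx.
case: (ltnP j i) => [ji|ij]; first exact: ltn_trans lx (dec _ _ _ _ ji lt_in yj xi).
rewrite ltnNge; apply/negP => yl; have {}yl : y < m l.
  by rewrite ltn_neqAle (column_neq_lrmin ln jn yj).
have li : l < i by rewrite -ltn_lrmin // (ltn_trans iy).
have w_li : precedes w (m l) (m i) by apply: (precedes_columns li); rewrite ?mem_head.
have w_ix : precedes w (m i) x by apply: precedes_lrmin xi.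
have w_iy : precedes w (m i) y by apply: precedes_lrmin yj.
have xw := mem_word_column m lt_in xi; have yw := mem_word_column m jn yj.
case: (ltngtP (index x w) (index y w)) => [xy|yx|exy].
- apply/av3142/contains_3142; exists (m l), (m i), x, y; rewrite /= iy yl lx.
  by rewrite subseq_precedes //= !mem_word_lrmin // xw yw w_li w_ix /precedes xy.
- apply/av3124/contains_3124; exists (m l), (m i), y, x; rewrite /= iy yl lx.
  by rewrite subseq_precedes //= !mem_word_lrmin // xw yw w_li w_iy /precedes yx.
- have eq_xy : x = y by apply: index_inj exy.
  by rewrite eq_xy ltnNge ltnW in lx.
Qed.

Lemma avoid_skew_columns : avoids basis3 w -> skew_columns m c n.
Proof.
move=> av; have dec : columns_decrease m c n.
  by apply/avoid_columns_decrease/av; left; left.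
split=> //; apply: avoid_minima_separate => //; apply: av; [by left; right|by right].
Qed.

Section AvoidanceInSkewColumns.
Hypotheses (dec : columns_decrease m c n) (sep : minima_separate m c n).

Lemma ascent_same_column i j x y : i < n -> j < n -> x \in c i -> y \in c j ->
  precedes w x y -> x < y -> i = j.
Proof.
move=> lt_in jn xi yj xy lt_xy; have : i <= j.
  by apply: (leq_precedes lt_in _ _ xy); rewrite inE ?xi ?yj orbT.
rewrite leq_eqVlt => /predU1P [<-//|ij].
by move: lt_xy; rewrite ltnNge ltnW // (dec ij jn xi yj).
Qed.

Lemma column_between j x y z : j < n -> x \in c j -> y \in c j -> z \in w ->
  precedes w x z -> precedes w z y -> z \in c j.
Proof.
move=> jn xj yj /mem_word [i lt_in zi] xz zy.
have xj' : x \in m j :: c j by rewrite inE xj orbT.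
have yj' : y \in m j :: c j by rewrite inE yj orbT.
have ei : i = j.
  by apply/eqP; rewrite eqn_leq (leq_precedes lt_in zi yj') // (leq_precedes jn xj' zi).
rewrite {i}ei inE in zi lt_in; case/predU1P: zi => [ez|//].
rewrite ez in xz; have := precedes_trans xz (precedes_lrmin (leqnn j) jn xj).
by rewrite precedesxx.
Qed.

Lemma ascent_over_column j x y z : j < n -> x \in c j -> y \in c j -> z \in w ->
  precedes w z y -> z < y -> x < z -> z \in c j.
Proof.
move=> jn xj yj /mem_word [i lt_in]; rewrite inE => /predU1P [->|zi] zy lt_zy lt_xz.
  have lt_mjx := lrmin_lt_column jn xj.
  by move: lt_xz; rewrite ltnNge ltnW // (sep jn jn lt_in yj xj).
by rewrite -(ascent_same_column lt_in jn zi yj zy lt_zy).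
Qed.

Lemma contains_2314_column : contains w [:: 2; 3; 1; 4] ->
  exists2 j, j < n & contains (c j) [:: 2; 3; 1; 4].
Proof.
case/contains_2314=> a [b [d [e [tw so]]]].
move: (tw) (so); rewrite subseq_precedes //= => /andP [/and5P [aw bw dw ew _]].
move=> /and4P [ab bd de _] /and4P [lt_da lt_ab lt_be _].
have [i lt_in bi] := ascent_column aw bw ab lt_ab.
have [j jn ej] := ascent_column bw ew (precedes_trans bd de) lt_be.
have bj : b \in c j.
  by rewrite -(ascent_same_column lt_in jn bi ej (precedes_trans bd de) lt_be).
have dj := column_between jn bj ej dw bd de.
have aj := ascent_over_column jn dj bj aw ab lt_ab lt_da.
exists j => //; apply/contains_2314; exists a, b, d, e; split=> //.
by apply: subseq_column; rewrite //= aj bj dj ej.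
Qed.

Lemma contains_3124_column : contains w [:: 3; 1; 2; 4] ->
  exists2 j, j < n & contains (c j) [:: 3; 1; 2; 4].
Proof.
case/contains_3124=> a [b [d [e [tw so]]]].
move: (tw) (so); rewrite subseq_precedes //= => /andP [/and5P [aw bw dw ew _]].
move=> /and4P [ab bd de _] /and4P [lt_bd lt_da lt_ae _].
have ae := precedes_trans ab (precedes_trans bd de).
have [i lt_in di] := ascent_column bw dw bd lt_bd.
have [j jn ej] := ascent_column aw ew ae lt_ae.
have dj : d \in c j.
  by rewrite -(ascent_same_column lt_in jn di ej de (ltn_trans lt_da lt_ae)).
have aj := ascent_over_column jn dj ej aw ae lt_ae lt_da.
have bj := column_between jn aj dj bw ab bd.
exists j => //; apply/contains_3124; exists a, b, d, e; split=> //.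
by apply: subseq_column; rewrite //= aj bj dj ej.
Qed.

Lemma contains_3142_column : contains w [:: 3; 1; 4; 2] ->
  exists2 j, j < n & contains (c j) [:: 3; 1; 4; 2].
Proof.
case/contains_3142=> a [b [d [e [tw so]]]].
move: (tw) (so); rewrite subseq_precedes //= => /andP [/and5P [aw bw dw ew _]].
move=> /and4P [ab bd de _] /and4P [lt_be lt_ea lt_ad _].
have ad := precedes_trans ab bd.
have [j jn dj] := ascent_column aw dw ad lt_ad.
have [l ln el] := ascent_column bw ew (precedes_trans bd de) lt_be.
have dj' : d \in m j :: c j by rewrite inE dj orbT.
have lt_mje : m j < e.
  apply: leq_ltn_trans lt_be; have /mem_word [k kn bk] := bw.
  exact: lrmin_leq_column (leq_precedes kn bk dj' bd) jn bk.
have aj : a \in c j.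
  have /mem_word [i lt_in] := aw; rewrite inE => /predU1P [ea|ai]; last first.
    by rewrite -(ascent_same_column lt_in jn ai dj ad lt_ad).
  by move: lt_ea; rewrite ltnNge ltnW // ea (sep jn ln lt_in dj el) -?ea.
have bj := column_between jn aj dj bw ab bd.
have ej : e \in c j.
  by rewrite (ascent_same_column jn ln bj el (precedes_trans bd de) lt_be).
exists j => //; apply/contains_3142; exists a, b, d, e; split=> //.
by apply: subseq_column; rewrite //= aj bj dj ej.
Qed.

Lemma avoids_basis3_word : (forall j, j < n -> avoids basis3 (c j)) -> avoids basis3 w.
Proof.
move=> av q [[->|->]|->].
- by case/contains_2314_column => j jn; apply: (av j jn); left; left.
- by case/contains_3124_column => j jn; apply: (av j jn); left; right.
- by case/contains_3142_column => j jn; apply: (av j jn); right.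
Qed.

Lemma filter_notin_lrmin : [seq x <- w | x \notin mkseq m n] = flatten (mkseq c n).
Proof.
rewrite filter_flatten -map_comp; congr flatten; apply/eq_in_map => j.
rewrite mem_iota => /= jn; rewrite map_f ?mem_iota //=; apply/all_filterP/allP => x.
exact: column_notin_lrmin.
Qed.

Lemma contains_one_oplus_word p : is_perm p -> p <> [::] -> skew_indecomposable p ->
  contains w (one_oplus p) -> exists2 j, j < n & contains (c j) p.
Proof.
move=> pp p0 sp [[|a u] aw]; first by case=> /esym/size0nil.
case/(order_iso_one_oplus _ _ pp) => iso /allP lt_au.
suff : contains (flatten (mkseq c n)) p.
  case/(skew_indecomposable_flatten pp p0 sp) => [|_ /mapP [j + ->] cp].
    apply/(pairwiseP [::]) => i j; rewrite !inE size_mkseq => lt_in jn ij.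
    by rewrite !nth_mkseq //; apply/allrelP => x y; apply: dec.
  by rewrite mem_iota => jn; exists j.
exists u => //; rewrite -filter_notin_lrmin subseq_filter.
rewrite (subseq_trans (subseq_cons u a) aw) andbT; apply/allP => y yu.
have sub_w := mem_subseq aw; move: aw; rewrite subseq_precedes // => /andP [_].
move=> /(order_path_min (@precedes_trans _ w))/allP/(_ y yu) ay.
have [||j jn yj] := ascent_column _ _ ay (lt_au y yu).
- exact/sub_w/mem_head.
- by apply: sub_w; rewrite inE yu orbT.
exact: column_notin_lrmin yj.
Qed.

End AvoidanceInSkewColumns.

Lemma contains_column_one_oplus j p : j < n -> is_perm p ->
  contains (c j) p -> contains w (one_oplus p).
Proof.
move=> jn pp [t tj iso]; exists (m j :: t).
  by apply: subseq_trans (column_subseq_word m c jn); rewrite /= eqxx.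
apply/(order_iso_one_oplus _ _ pp); split=> //; apply/allP => x /(mem_subseq tj).
exact: lrmin_lt_column.
Qed.

Local Open Scope classical_set_scope.

Lemma avoids_wordP (P : set (seq nat)) :
  (forall p, P p -> [/\ is_perm p, p <> [::] & skew_indecomposable p]) ->
  avoids (basis3 `|` one_oplus @` P) w <->
  skew_columns m c n /\ forall j, (j < n)%N -> avoids (basis3 `|` P) (c j).
Proof.
move=> Pp; split=> [av|[[dec sep] av] q].
  split=> [|j jn q [bq|Pq] cq].
  - by apply: avoid_skew_columns => q bq; apply: av; left.
  - apply: (av q); first by left.
    apply: contains_subseq cq; apply: subseq_trans (column_subseq_word m c jn).
    exact: subseq_cons.
  - have [pq _ _] := Pp q Pq; apply: (av (one_oplus q)); first by right; exists q.
    exact: contains_column_one_oplus cq.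
case=> [bq|[p p_P <-]].
  by apply: avoids_basis3_word => // j jn q' bq'; apply: av => //; left.
have [pp p0 sp] := Pp p p_P.
by case/(contains_one_oplus_word dec pp p0 sp) => j jn; apply: av => //; right.
Qed.

End SkewColumns.

(** * Independent fillings *)

Lemma cell_row_leq_col n (d : cell n) : cell_row d <= cell_col d.
Proof. by have := valP d; rewrite inE. Qed.

Lemma eq_cell n (d e : cell n) :
  cell_row d = cell_row e :> nat -> cell_col d = cell_col e :> nat -> d = e.
Proof.
move=> er ec; apply: val_inj; rewrite [LHS]surjective_pairing [RHS]surjective_pairing.
by congr pair; apply: val_inj.
Qed.

Lemma exists_cell n i j : i <= j -> j < n ->
  exists d : cell n, cell_row d = i :> nat /\ cell_col d = j :> nat.
Proof.
move=> ij jn; have lt_in := leq_ltn_trans ij jn.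
have dP : (Ordinal lt_in, Ordinal jn) \in staircase n by rewrite inE.
by exists (exist (fun e => e \in staircase n) _ dP).
Qed.

Lemma rectangle_sub_staircase n (d e : cell n) :
  cell_row d <= cell_row e -> cell_col d <= cell_col e ->
  (rectangle (cell_row d) (cell_row e) (cell_col d) (cell_col e) \subset staircase n) =
  (cell_row e <= cell_col d).
Proof.
move=> rde cde; apply/fintype.subsetP/idP => [rect|le_ed].
  have := rect (cell_row e, cell_col d); rewrite !inE /= rde cde !leqnn.
  exact.
move=> [i j]; rewrite !inE /= => /andP [/andP [_ ie] /andP [dj _]].
exact: leq_trans ie (leq_trans le_ed dj).
Qed.

(* If [cell_row d < cell_row e <= cell_col d], then [d] and [e] are joined by a down,
   column or up edge according to the order of their columns. *)
Lemma independent_UDCP n (A : {set cell n}) :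
  independent (@UDC n) A <->
  {in A &, forall d e, cell_row e <= cell_col d -> cell_row e <= cell_row d}.
Proof.
split=> [ind d e dA eA le_ed|row_le d e dA eA].
  rewrite leqNgt; apply/negP => lt_de; have := ind _ _ dA eA.
  have neq_de : d != e by apply: contraTneq lt_de => ->; rewrite ltnn.
  rewrite /UDC neq_de /up_edge /down_edge lt_de /=.
  case: (ltngtP (cell_col d) (cell_col e)) => [lt_c|lt_c|/val_inj->].
  - by rewrite rectangle_sub_staircase ?le_ed ?orbT // ltnW.
  - by rewrite orbT.
  - by rewrite eqxx !orbT.
have no_up d' e' : d' \in A -> e' \in A -> ~~ up_edge d' e'.
  move=> d'A e'A; apply/negP => /andP [lt_r lt_c].
  have := row_le e' d' e'A d'A (leq_trans (cell_row_leq_col d') (ltnW lt_c)).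
  by rewrite leqNgt lt_r.
have no_down d' e' : d' \in A -> e' \in A -> ~~ down_edge d' e'.
  move=> d'A e'A; apply/negP => /and3P [lt_r lt_c].
  rewrite (rectangle_sub_staircase (ltnW lt_r) (ltnW lt_c)) => le_ed.
  by have := row_le d' e' d'A e'A le_ed; rewrite leqNgt lt_r.
rewrite /UDC !(negbTE (no_up _ _ _ _), negbTE (no_down _ _ _ _)) //=.
rewrite negb_and negbK; case: eqP => //= neq_de; apply/eqP => ec; apply: neq_de.
apply: eq_cell; last by rewrite ec.
by apply/eqP; rewrite eqn_leq; apply/andP; split; apply: row_le => //;
  [rewrite -ec | rewrite ec]; apply: cell_row_leq_col.
Qed.

(** * The encoding of skew columns *)

Section EncodingSkewColumns.
Variables (m : nat -> nat) (c : nat -> seq nat) (n : nat).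
Hypotheses (mc : lrmin_columns m c n) (sep : minima_separate m c n).

Lemma row_of_leq_column j x : j < n -> x \in c j -> row_of m n x <= j.
Proof. by move=> jn xj; rewrite (row_of_leq _ mc) // (lrmin_lt_column mc). Qed.

Lemma minima_separate_row i j x y : i < n -> j < n -> x \in c i -> y \in c j ->
  row_of m n y <= i -> row_of m n y <= row_of m n x.
Proof.
move=> lt_in jn xi yj; have rn := leq_ltn_trans (row_of_leq_column lt_in xi) lt_in.
rewrite !(row_of_leq _ mc) // => lt_iy; apply: (sep lt_in jn rn xi yj lt_iy).
by rewrite -(row_of_leq _ mc).
Qed.

Lemma row_of_column j x y : j < n -> x \in c j -> y \in c j ->
  row_of m n x = row_of m n y.
Proof.
by move=> jn xj yj; apply/eqP; rewrite eqn_leq !(minima_separate_row jn jn)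
  ?row_of_leq_column.
Qed.

Lemma filter_row_of_column j x : j < n -> x \in c j ->
  [seq y <- c j | row_of m n y == row_of m n x] = c j.
Proof.
by move=> jn xj; apply/all_filterP/allP => y yj; rewrite (row_of_column jn yj xj).
Qed.

Lemma nonempty_cells_SE (d : cell n) :
  reflect (exists2 x, x \in c (cell_col d) & row_of m n x = cell_row d)
          (d \in nonempty_cells (SE n (word m c n))).
Proof.
rewrite inE SE_word // standardize_nil -has_filter.
by apply: (iffP hasP) => -[x xc /eqP rx]; exists x => //; apply/eqP.
Qed.

Lemma independent_SE :
  independent (@UDC n) (nonempty_cells (SE n (word m c n))).
Proof.
apply/independent_UDCP => d e /nonempty_cells_SE [x xd <-] /nonempty_cells_SE [y ye <-].
exact: minima_separate_row (ltn_ord _) (ltn_ord _) xd ye.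
Qed.

Lemma SE_word_WI (Q : set (seq nat)) : uniq (word m c n) ->
  (forall j, j < n -> avoids Q (c j)) ->
  WI (@UDC n) (Av_plus Q) (SE n (word m c n)).
Proof.
move=> uw av; split=> [|d]; first exact: independent_SE.
rewrite inE => /eqP d0; split=> //; rewrite SE_word //.
have dc := filter_subseq (fun x => row_of m n x == cell_row d) (c (cell_col d)).
split=> [|q Qq /contains_standardize /(contains_subseq dc)]; last exact: av.
apply: is_perm_standardize; apply: subseq_uniq dc _.
apply: subseq_uniq (subseq_trans (subseq_cons _ _) _) uw.
exact: column_subseq_word (ltn_ord _).
Qed.

End EncodingSkewColumns.

(** * Injectivity *)

Lemma size_word_eq m c m' c' n : (forall j, j < n -> size (c j) = size (c' j)) ->
  size (word m c n) = size (word m' c' n).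
Proof.
by elim: n => // n IH sz; rewrite !size_wordS sz ?IH // => j /ltnW; apply: sz.
Qed.

Lemma mem_zip_word m c m' c' n u : (forall j, j < n -> size (c j) = size (c' j)) ->
  u \in zip (word m c n) (word m' c' n) ->
  exists2 j, j < n & u = (m j, m' j) \/ u \in zip (c j) (c' j).
Proof.
elim: n => // n IH sz; have szW j : j < n -> size (c j) = size (c' j) by move/ltnW/sz.
rewrite !wordS zip_cat; last exact: size_word_eq.
rewrite mem_cat inE => /or3P [|/eqP ->|un].
- by case/(IH szW) => j jn ?; exists j; first exact: ltnW.
- by exists n; last left.
- by exists n; last right.
Qed.

Lemma SE_word_column m c m' c' n j x :
  lrmin_columns m c n -> lrmin_columns m' c' n ->
  minima_separate m c n -> minima_separate m' c' n ->
  SE n (word m c n) = SE n (word m' c' n) -> j < n -> x \in c j ->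
  order_iso (c j) (c' j) /\ {in c' j, forall y, row_of m' n y = row_of m n x}.
Proof.
move=> mc mc' sep sep' eSE jn xj.
have [d [rd cd]] := exists_cell (row_of_leq_column mc jn xj) jn.
have : standardize (c j) = standardize [seq y <- c' j | row_of m' n y == row_of m n x].
  by rewrite -{1}(filter_row_of_column mc sep jn xj) -{}rd -cd -!SE_word // eSE.
set cell' := [seq y <- c' j | _] => eq_std.
have /nonnil_mem [y] : cell' != [::].
  by rewrite -standardize_nil -eq_std standardize_nil; apply: contraTneq xj => ->.
rewrite mem_filter => /andP [/eqP ry yj]; split.
  by apply/standardizeP; rewrite eq_std /cell' -ry (filter_row_of_column mc' sep').
by move=> z zj; rewrite -ry (row_of_column mc' sep' jn zj yj).
Qed.

Section Injectivity.
Variables (m m' : nat -> nat) (c c' : nat -> seq nat) (n : nat).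
Local Notation w := (word m c n).
Local Notation w' := (word m' c' n).
Hypotheses (mc : lrmin_columns m c n) (mc' : lrmin_columns m' c' n).
Hypotheses (uw : uniq w) (uw' : uniq w').
Hypotheses (skew : skew_columns m c n) (skew' : skew_columns m' c' n).
Hypothesis eSE : SE n w = SE n w'.

Lemma order_iso_column j : j < n -> order_iso (c j) (c' j).
Proof.
move=> jn; have [[_ sep] [_ sep']] := (skew, skew').
have [ec|/nonnil_mem [x xj]] := eqVneq (c j) [::]; last first.
  by have [] := SE_word_column mc mc' sep sep' eSE jn xj.
have [ec'|/nonnil_mem [y yj]] := eqVneq (c' j) [::]; first by rewrite ec ec'.
apply: order_iso_sym.
by have [] := SE_word_column mc' mc sep' sep (esym eSE) jn yj.
Qed.

Lemma row_of_column_eq j x y : j < n -> x \in c j -> y \in c' j ->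
  row_of m n x = row_of m' n y.
Proof.
move=> jn xj yj; have [[_ sep] [_ sep']] := (skew, skew').
by have [_ ->] := SE_word_column mc mc' sep sep' eSE jn xj.
Qed.

Lemma order_iso_word : order_iso w w'.
Proof.
have sz j : j < n -> size (c j) = size (c' j) by move=> /order_iso_column [].
have [[dec _] [dec' _]] := (skew, skew').
have lrmin_lt i j x y : i < n -> j < n -> x \in c j -> y \in c' j ->
    (m i < x) = (m' i < y).
  move=> lt_in jn xj yj; rewrite -(row_of_leq _ mc) // -(row_of_leq _ mc') //.
  by rewrite (row_of_column_eq jn xj yj).
apply/order_iso_zip; split=> [|u v]; first exact: size_word_eq.
move=> /(mem_zip_word sz) [i lt_in ui] /(mem_zip_word sz) [j jn vj].
case: ui => [->|ui] /=; case: vj => [->|vj] /=.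
- by rewrite (ltn_lrmin mc) // (ltn_lrmin mc').
- by have [v1 v2] := mem_zip (sz _ jn) vj; apply: lrmin_lt jn _ _.
- have [u1 u2] := mem_zip (sz _ lt_in) ui.
  rewrite (ltn_column_lrmin uw jn lt_in u1) (ltn_column_lrmin uw' jn lt_in u2).
  by congr negb; apply: lrmin_lt lt_in _ _.
have [[u1 u2] [v1 v2]] := (mem_zip (sz _ lt_in) ui, mem_zip (sz _ jn) vj).
case: (ltngtP i j) => [ij|ji|eij].
- rewrite (leq_gtF (ltnW (dec _ _ _ _ ij jn u1 v1))).
  by rewrite (leq_gtF (ltnW (dec' _ _ _ _ ij jn u2 v2))).
- by rewrite (dec _ _ _ _ ji lt_in v1 u1) (dec' _ _ _ _ ji lt_in v2 u2).
- have /order_iso_zip [_ ->] // := order_iso_column lt_in.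
  by rewrite eij.
Qed.

End Injectivity.

(** * Surjectivity *)

Lemma is_lrmin_order_iso s t k : order_iso s t -> k < size s ->
  is_lrmin s k = is_lrmin t k.
Proof.
move=> [_ lt_st] ks; apply: eq_in_all => l; rewrite mem_iota /= => lk.
by rewrite lt_st // (ltn_trans lk).
Qed.

Lemma lrmin_pos_order_iso s t : order_iso s t -> lrmin_pos s = lrmin_pos t.
Proof.
move=> iso; rewrite /lrmin_pos -(proj1 iso); apply: eq_in_filter => k.
by rewrite mem_iota => /= ks; apply: is_lrmin_order_iso.
Qed.

Lemma row_index_order_iso s t k i : order_iso s t -> k < size s ->
  row_index s k i = row_index t k i.
Proof.
move=> iso ks; have [_ lt_st] := iso.
rewrite !row_indexE /lrmin_val -(lrmin_pos_order_iso iso) !size_map !find_map.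
congr (_ && (_ == _)); apply: eq_in_find => l /lrmin_pos_lt ls /=.
exact: lt_st.
Qed.

Lemma SE_order_iso n s t : order_iso s t -> SE n s = SE n t.
Proof.
move=> iso; have [est lt_st] := iso.
apply/ffunP => d; rewrite !ffunE /cell_entries -est.
set ks := [seq k <- _ | _]; set ks' := [seq k <- _ | _].
have <- : ks = ks'.
  apply: eq_in_filter => k; rewrite mem_iota => /= ks_k.
  rewrite (row_index_order_iso _ iso) // /col_index (lrmin_pos_order_iso iso).
  by rewrite (is_lrmin_order_iso iso).
apply/standardizeP; split=> [|k l]; rewrite !size_map // => ltk ltl.
have ks_lt h : h \in ks -> h < size s by rewrite mem_filter mem_iota => /andP [].
by rewrite !(nth_map 0) // lt_st //; apply/ks_lt/mem_nth.
Qed.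

Lemma ltn_lex q y z y' z' : z < q -> z' < q ->
  (y * q + z < y' * q + z') = (y < y') || (y == y') && (z < z').
Proof.
have lt_row u v u' v' : v < q -> u < u' -> u * q + v < u' * q + v'.
  move=> vq lt_u; apply: leq_trans (leq_addr _ _); apply: (@leq_trans (u.+1 * q)).
    by rewrite mulSnr ltn_add2l.
  by rewrite leq_mul2r lt_u orbT.
move=> zq z'q; case: (ltngtP y y') => [lt_y|lt_y|->]; last by rewrite ltn_add2l.
- exact: lt_row.
- by rewrite ltnNge ltnW ?lt_row.
Qed.

(* Lexicographic in [(i, j, x)] with [i] and [j] reversed: a row is an interval
   of values, cut into one interval of length [b] per column; below them all, the
   spare column [n] holds the minimum of the row. *)
Definition lex_value (n b i j x : nat) : nat := ((n - i) * n.+1 + (n - j)) * b + x.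

Lemma ltn_lex_value n b i j x i' j' x' :
  i <= n -> j <= n -> x < b -> i' <= n -> j' <= n -> x' < b ->
  (lex_value n b i j x < lex_value n b i' j' x') =
  (i' < i) || (i' == i) && ((j' < j) || (j' == j) && (x < x')).
Proof.
move=> le_in jn xb le_in' jn' xb'; rewrite /lex_value ltn_lex //.
have eq_ltn y z : (y == z) = ~~ (y < z) && ~~ (z < y) by case: ltngtP.
rewrite {1}eq_ltn !(@ltn_lex n.+1) ?ltnS ?leq_subr //.
have ltn_rev k l : k <= n -> l <= n -> (n - k < n - l) = (l < k) by lia.
have eq_rev k l : k <= n -> l <= n -> (n - k == n - l) = (l == k) by lia.
rewrite !ltn_rev // !eq_rev //.
by case: (ltngtP i i'); case: (ltngtP j j').
Qed.

Section FillingWord.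
Variables (n : nat) (f : filling n).
Hypothesis fP : forall d, is_perm (f d).

Definition filling_bound : nat := (\max_(d : cell n) size (f d)).+1.

Definition filling_min (i : nat) : nat := lex_value n filling_bound i n 0.

Definition filling_entry (d : cell n) (x : nat) : nat :=
  lex_value n filling_bound (cell_row d) (cell_col d) x.

Definition filling_column (j : nat) : seq nat :=
  \big[cat/[::]]_(d : cell n | cell_col d == j :> nat) map (filling_entry d) (f d).

Lemma mem_filling_bound d x : x \in f d -> 0 < x < filling_bound.
Proof.
rewrite mem_is_perm // => /andP [-> xs]; rewrite ltnS (leq_trans xs) //.
exact: (leq_bigmax (F := fun d => size (f d))).
Qed.

Lemma filling_column_mem j x : x \in filling_column j ->
  exists d y, [/\ cell_col d = j :> nat, y \in f d & x = filling_entry d y].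
Proof.
rewrite /filling_column (big_morph (fun s => x \in s) (mem_cat x) (in_nil x)) big_orE.
by case/existsP=> d /andP [/eqP dj /mapP [y yd ->]]; exists d, y.
Qed.

Lemma filling_min_lt i j : i < j -> j < n -> filling_min j < filling_min i.
Proof.
by move=> ij jn; rewrite ltn_lex_value ?ij // ltnW // (ltn_trans ij).
Qed.

Lemma filling_min_lt_entry d x i : x \in f d -> i < n ->
  (filling_min i < filling_entry d x) = (cell_row d <= i).
Proof.
move=> /mem_filling_bound /andP [_ xb] lt_in.
have [rn cn] := (ltn_ord (cell_row d), ltn_ord (cell_col d)).
rewrite (ltn_lex_value (ltnW lt_in)) ?(ltnW rn) ?(ltnW cn) // cn andbT.
by rewrite orbC -leq_eqVlt.
Qed.

Lemma filling_entry_lt_min d x i : x \in f d -> i < n ->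
  (filling_entry d x < filling_min i) = (i < cell_row d).
Proof.
move=> /mem_filling_bound /andP [_ xb] lt_in.
have [rn cn] := (ltn_ord (cell_row d), ltn_ord (cell_col d)).
rewrite (ltn_lex_value (ltnW rn) (ltnW cn)) ?(ltnW lt_in) //.
by rewrite (leq_gtF (ltnW cn)) (gtn_eqF cn) andbF orbF.
Qed.

Lemma filling_entry_skew d e x y : x \in f d -> y \in f e ->
  cell_row d <= cell_row e -> cell_col d < cell_col e ->
  filling_entry e y < filling_entry d x.
Proof.
move=> /mem_filling_bound /andP [_ xb] /mem_filling_bound /andP [_ yb] rde cde.
by rewrite ltn_lex_value ?(ltnW (ltn_ord _)) // cde andbT orbC -leq_eqVlt.
Qed.

Lemma order_iso_filling_entry d : order_iso (f d) (map (filling_entry d) (f d)).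
Proof. by apply: order_iso_map => x y _ _; rewrite ltn_add2l. Qed.

Lemma lrmin_columns_filling : lrmin_columns filling_min filling_column n.
Proof.
have entry_gt i j x : i <= j -> j < n -> x \in filling_column i -> filling_min j < x.
  move=> ij jn /filling_column_mem [d [y [di yd ->]]].
  by rewrite filling_min_lt_entry // (leq_trans (cell_row_leq_col d)) // di.
move=> j x jn; rewrite mem_cat => /orP [/mem_word [i ij]|]; last exact: entry_gt.
rewrite inE => /predU1P [->|]; last exact/entry_gt/jn/ltnW.
exact: filling_min_lt.
Qed.

Lemma row_of_filling_entry d y : y \in f d ->
  row_of filling_min n (filling_entry d y) = cell_row d.
Proof.
move=> yd; have rn := ltn_ord (cell_row d).
have row_leq i : i < n ->
    (row_of filling_min n (filling_entry d y) <= i) = (cell_row d <= i).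
  by move=> lt_in; rewrite (row_of_leq _ lrmin_columns_filling) // filling_min_lt_entry.
have le_r : row_of filling_min n (filling_entry d y) <= cell_row d by rewrite row_leq.
by apply/eqP; rewrite eqn_leq le_r -row_leq ?leqnn ?(leq_ltn_trans le_r rn).
Qed.

Lemma filter_row_filling_column d :
  [seq x <- filling_column (cell_col d) | row_of filling_min n x == cell_row d] =
  map (filling_entry d) (f d).
Proof.
pose in_row x := row_of filling_min n x == cell_row d.
have filter_nil : filter in_row [::] = [::] by [].
rewrite /filling_column (big_morph _ (filter_cat in_row) filter_nil).
transitivity (\big[cat/[::]]_(e | e == d) map (filling_entry e) (f e)); last first.
  exact: big_pred1_eq.
rewrite big_mkcond [RHS]big_mkcond; apply: eq_bigr => e _.
have filter_row : filter in_row (map (filling_entry e) (f e)) =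
    if cell_row e == cell_row d then map (filling_entry e) (f e) else [::].
  case: eqP => [er|/eqP neq_row].
    apply/all_filterP/allP => _ /mapP [y ye ->].
    by rewrite /in_row row_of_filling_entry // er.
  apply/eqP; rewrite -[_ == _]negbK -has_filter; apply/hasPn => _ /mapP [y ye ->].
  by rewrite /in_row row_of_filling_entry.
rewrite filter_row; case: (eqVneq e d) => [->|neq_ed]; first by rewrite !eqxx.
case: eqP => // ec; case: eqP => // er; case/eqP: neq_ed.
by apply: eq_cell => //; rewrite er.
Qed.

Lemma SE_filling_word : SE n (word filling_min filling_column n) = f.
Proof.
apply/ffunP => d.
rewrite (SE_word _ lrmin_columns_filling) filter_row_filling_column.
rewrite -[RHS]standardize_is_perm //; apply/esym/standardizeP.
exact: order_iso_filling_entry.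
Qed.

Hypothesis ind : independent (@UDC n) (nonempty_cells f).

Lemma filling_row_leq d e x y : x \in f d -> y \in f e ->
  cell_row e <= cell_col d -> cell_row e <= cell_row d.
Proof.
move=> xd ye; apply: (proj1 (independent_UDCP _) ind); rewrite inE.
  by apply: contraTneq xd => ->.
by apply: contraTneq ye => ->.
Qed.

Lemma skew_columns_filling : skew_columns filling_min filling_column n.
Proof.
split=> [i j _ _ ij jn|i j l _ _ lt_in jn ln] /filling_column_mem [d [x [ci xd ->]]]
    /filling_column_mem [e [y [cj ye ->]]].
  have cde : cell_col d < cell_col e by rewrite ci cj.
  apply: filling_entry_skew => //; apply: filling_row_leq ye xd _.
  exact: leq_trans (cell_row_leq_col d) (ltnW cde).
rewrite !filling_min_lt_entry // -ci => le_ed.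
exact/leq_trans/(filling_row_leq xd ye).
Qed.

Lemma filling_column_cases j : j < n ->
  filling_column j = [::] \/
  exists2 d, f d != [::] & filling_column j = map (filling_entry d) (f d).
Proof.
move=> jn; case: (eqVneq (filling_column j) [::]) => [|/nonnil_mem [x xj]].
  by left.
right; have [d [y [dj yd ex]]] := filling_column_mem xj.
exists d; first by apply: contraTneq yd => ->.
rewrite -filter_row_filling_column dj -(row_of_filling_entry yd) -ex.
have [_ sep] := skew_columns_filling.
by rewrite (filter_row_of_column lrmin_columns_filling sep).
Qed.

Lemma uniq_filling_word : uniq (word filling_min filling_column n).
Proof.
apply: uniq_word => [|j jn|j x jn xj]; first exact: lrmin_columns_filling.
  case: (filling_column_cases jn) => [->//|[d _ ->]].
  apply: order_iso_uniq (order_iso_filling_entry d) _; exact: is_perm_uniq.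
apply/mem_word => -[i ij]; rewrite inE => /predU1P [ex|xi].
  have [d [y [_ yd ex']]] := filling_column_mem xj.
  have lt_in := ltn_trans ij jn.
  have := filling_min_lt_entry yd lt_in; have := filling_entry_lt_min yd lt_in.
  by rewrite -ex' -ex ltnn => /esym; rewrite ltnNge => /negbFE ->.
by have := proj1 skew_columns_filling _ _ _ _ ij jn xi xj; rewrite ltnn.
Qed.

Lemma avoids_filling_column Q j : ~ Q [::] ->
  (forall d, f d != [::] -> avoids Q (f d)) -> j < n -> avoids Q (filling_column j).
Proof.
move=> Q0 av jn q Qq; case: (filling_column_cases jn) => [->|[d d0 ->]].
  by case=> t; rewrite subseq0 => /eqP -> [/esym/size0nil eq _]; apply: Q0; rewrite -eq.
move/(contains_order_iso (order_iso_sym (order_iso_filling_entry d))); exact: av.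
Qed.

End FillingWord.

Lemma standardize_Av_lrmin n (Q : set (seq nat)) m c :
  lrmin_columns m c n -> uniq (word m c n) -> avoids Q (word m c n) ->
  Av_lrmin n Q (standardize (word m c n)).
Proof.
move=> mc uw av; have iso := order_iso_standardize (word m c n); split; last first.
  by rewrite -(lrmin_pos_order_iso iso) lrmin_pos_word // size_mkseq.
by split=> [|q Qq /contains_standardize]; [apply: is_perm_standardize | apply: av].
Qed.

Local Open Scope classical_set_scope.

Section BijectionOnAvoiders.
Variable P : set (seq nat).
Hypothesis Pp : forall p, P p -> [/\ is_perm p, p <> [::] & skew_indecomposable p].

Lemma Av_lrmin_word n s : Av_lrmin n (basis3 `|` one_oplus @` P) s ->
  exists m c, s = word m c n /\
    [/\ lrmin_columns m c n, uniq (word m c n), skew_columns m c n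
      & forall j, (j < n)%N -> avoids (basis3 `|` P) (c j)].
Proof.
move=> [[/is_perm_uniq us av] sn]; have [k [m [c [es mc]]]] := word_exists us.
have ek : k = n by rewrite -sn es lrmin_pos_word // size_mkseq.
subst k s; exists m, c; split=> //.
by have [? ?] := (avoids_wordP mc us Pp).1 av.
Qed.

Lemma SE_WI n s : Av_lrmin n (basis3 `|` one_oplus @` P) s ->
  WI (@UDC n) (Av_plus (basis3 `|` P)) (SE n s).
Proof. by case/Av_lrmin_word=> m [c [-> [mc uw [_ sep] av]]]; apply: SE_word_WI. Qed.

Lemma SE_injective n s t : Av_lrmin n (basis3 `|` one_oplus @` P) s ->
  Av_lrmin n (basis3 `|` one_oplus @` P) t -> SE n s = SE n t -> s = t.
Proof.
move=> s_Av t_Av eSE; have [[[ps _] _] [[pt _] _]] := (s_Av, t_Av).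
apply: order_iso_is_perm_eq => //; move: eSE.
have [m [c [-> [mc uw sk _]]]] := Av_lrmin_word s_Av.
have [m' [c' [-> [mc' uw' sk' _]]]] := Av_lrmin_word t_Av.
exact: order_iso_word.
Qed.

Lemma SE_surjective n f : WI (@UDC n) (Av_plus (basis3 `|` P)) f ->
  exists2 s, Av_lrmin n (basis3 `|` one_oplus @` P) s & SE n s = f.
Proof.
move=> [ind f_Av]; set Q := basis3 `|` P in f_Av.
have fAv d : f d != [::] -> Av Q (f d) by move=> d0; have [] := f_Av d; rewrite ?inE.
have fP d : is_perm (f d) by case: (eqVneq (f d) [::]) => [->|/fAv []].
have Q0 : ~ Q [::] by case=> [[[]|]|/Pp []].
have [mc uw] := (lrmin_columns_filling fP, uniq_filling_word fP ind).
exists (standardize (word (filling_min f) (filling_column f) n)).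
  apply: standardize_Av_lrmin => //; apply/(avoids_wordP mc uw Pp).
  split=> [|j]; first exact: skew_columns_filling.
  by apply: avoids_filling_column => // d /fAv [].
by rewrite -(SE_order_iso n (order_iso_standardize _)) SE_filling_word.
Qed.

End BijectionOnAvoiders.

Theorem theorem6p1 (P : set (seq nat))
    (P_perm : forall p, P p -> is_perm p /\ p <> [::])
    (P_skew : forall p, P p -> skew_indecomposable p)
    (n : nat) :
  set_bij (Av_lrmin n (basis3 `|` one_oplus @` P))
          (WI (@UDC n) (Av_plus (basis3 `|` P)))
          (SE n).
Proof.
have Pp p : P p -> [/\ is_perm p, p <> [::] & skew_indecomposable p].
  by move=> p_P; have [pp p0] := P_perm p p_P; split=> //; apply: P_skew.
split=> [s|s t /set_mem s_Av /set_mem t_Av|f].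
- exact: (SE_WI Pp).
- exact: (SE_injective Pp s_Av t_Av).
- by case/(SE_surjective Pp)=> s s_Av <-; exists s.
Qed.
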